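(* Let $n\ge 2$ be an integer, let $F$ be a real algebraic number field of degree $n$ over $\mathbb{Q}$, and let $\phi$ be a quasiperiodic flow on $T^n$ generated by the constant vector field $X=\sum_{i=1}^n a_i\,\partial/\partial\theta_i$ (with $a_i\in\mathbb{R}$). If $\phi$ is $F$-algebraic, then the multiplier group $\rho_\phi(S_\phi)$ is a subgroup of $\mathfrak{o}_F^*$, the group of units of the ring of integers of $F$.
   Context: Let $T^n=(\mathbb{R}/\mathbb{Z})^n$ be the $n$-torus ($n\ge 2$) with fixed global coordinates $(\theta_1,\dots,\theta_n)$, let $\mathrm{Diff}(T^n)$ be its group of $C^\infty$ diffeomorphisms, and let $\mathbb{R}^*=\mathbb{R}\setminus\{0\}$ be the multiplicative group of nonzero reals. A flow $\phi:\mathbb{R}\times T^n\to T^n$ is a smooth complete flow; its generating vector field is $X(p)=\frac{d}{dt}\phi(t,p)|_{t=0}$. It is nontrivial if $X$ is not identically zero. For $R\in\mathrm{Diff}(T^n)$, the push-forward is $R_*X=\mathbf{T}R\circ X\circ R^{-1}$, where $\mathbf{T}R$ is the tangent map. An $R\in\mathrm{Diff}(T^n)$ is a generalized symmetry of $\phi$ if there is $\alpha\in\mathbb{R}^*$ with $R_*X=\alpha X$; $\alpha$ is then a multiplier of $R$ (unique when $\phi$ is nontrivial). $S_\phi$ denotes the group of generalized symmetries of $\phi$. For nontrivial $\phi$, the homomorphism $\rho_\phi:S_\phi\to\mathbb{R}^*$ sends $R$ to its unique multiplier, and its image $\rho_\phi(S_\phi)=\{\alpha\in\mathbb{R}^*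 : R_*X=\alpha X\text{ for some }R\in\mathrm{Diff}(T^n)\}$ is the multiplier group of $\phi$. A flow generated by $X$ is quasiperiodic if there are $V\in\mathrm{Diff}(T^n)$ and a constant vector field $Y$ whose $n$ real components are linearly independent over $\mathbb{Q}$ such that $V_*X=Y$. Quasiperiodic flows are nontrivial. A real algebraic number field of degree $n$ over $\mathbb{Q}$ is a subfield $F\subset\mathbb{R}$ with $\dim_{\mathbb{Q}}F=n$; a basis for $F$ means a basis of $F$ as a $\mathbb{Q}$-vector space. A quasiperiodic flow on $T^n$ generated by a constant vector field $\sum_{i=1}^n a_i\,\partial/\partial\theta_i$ is called $F$-algebraic if there is $\vartheta\in\mathbb{R}^*$ such that $\{\vartheta a_1,\dots,\vartheta a_n\}$ is a basis for $F$. $\mathfrak{o}_F$ is the ring of algebraic integers in $F$, and $\mathfrak{o}_F^*$ is its group of units. *)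

(* Defs.v *)
From HB Require Import structures.
From mathcomp Require Import all_boot all_order all_algebra ring_quotient.
From mathcomp Require Import all_classical all_reals all_analysis.
Set Implicit Arguments.
Unset Strict Implicit.
Unset Printing Implicit Defensive.
Import Order.TTheory GRing.Theory Num.Theory.
Import numFieldNormedType.Exports.
Local Open Scope classical_set_scope.
Local Open Scope ring_scope.

Section Smooth.
Variables (R : realType) (V W : normedModType R).

(* Meant for open U and finite-dimensional V, where a map x |-> 'd f x into
   the linear maps is C^k iff all its evaluations x |-> 'd f x v are. *)
Fixpoint Ck (k : nat) (U : set V) (f : V -> W) : Prop :=
  match k with
  | 0 => forall x, U x -> {for x, continuous f}
  | k'.+1 => (forall x, U x -> differentiable f x) /\
             (forall v, Ck k' U (fun x => 'd f x v))
  end.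

Definition smooth_near (f : V -> W) (x : V) : Prop :=
  exists2 U : set V, open_nbhs x U & forall k, Ck k U f.

End Smooth.

Section Torus.
Variables (R : realType) (n : nat).

Definition Zsubgroup : zmodClosed R :=
  GRing.ZmodClosed.clone R (@Num.int_num_subdef R) _.

Definition circle := Quotient.quot Zsubgroup.

Definition torus := 'rV[circle]_n.

Definition tproj (x : 'rV[R]_n) : torus := map_mx \pi_circle%qT x.

(* The representative of c in [-1/2, 1/2[. *)
Definition centered (c : circle) : R :=
  repr c - (Num.floor (repr c + 2^-1))%:~R.

(* The coordinates (theta_1, ..., theta_n) translated so as to vanish at p.
   This inverts h |-> p + tproj h near h = 0, and is a chart around p (its
   discontinuities lie at coordinates -1/2, away from p).  These charts differ
   by translations, so they all induce the global frame d/dtheta_i: tangent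
   vectors at every point are written as elements of 'rV[R]_n. *)
Definition chart (p q : torus) : 'rV[R]_n :=
  \row_i centered (q 0 i - p 0 i).

(* The expression of f in the charts centred at p and f p.  When it is
   continuous at 0 it has small values near 0, so f maps a neighbourhood of p
   into the domain of the chart at f p, as required in the definition of a
   smooth map. *)
Definition local_expr (f : torus -> torus) (p : torus) (h : 'rV[R]_n) :
  'rV[R]_n := chart (f p) (f (p + tproj h)).

Definition smooth_map (f : torus -> torus) : Prop :=
  forall p, smooth_near (local_expr f p) 0.

Definition tangent_map (f : torus -> torus) (p : torus) (v : 'rV[R]_n) :
  'rV[R]_n := 'd (local_expr f p) 0 v.

Record diffeo := Diffeo {
  diffeo_fun :> torus -> torus;
  diffeo_inv : torus -> torus;
  diffeoK : cancel diffeo_fun diffeo_inv;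
  diffeo_invK : cancel diffeo_inv diffeo_fun;
  diffeo_smooth : smooth_map diffeo_fun;
  diffeo_inv_smooth : smooth_map diffeo_inv
}.

Definition pushforward (f : diffeo) (X : torus -> 'rV[R]_n) (q : torus) :
  'rV[R]_n := tangent_map f (diffeo_inv f q) (X (diffeo_inv f q)).

Definition smooth_flow (phi : R -> torus -> torus) : Prop :=
  forall t p, smooth_near
    (fun sh : R * 'rV[R]_n =>
       chart (phi t p) (phi (t + sh.1) (p + tproj sh.2))) 0.

Record flow := Flow {
  flow_fun :> R -> torus -> torus;
  flow_smooth : smooth_flow flow_fun;
  flow0 : forall p, flow_fun 0 p = p;
  flowD : forall s t p, flow_fun (s + t) p = flow_fun s (flow_fun t p)
}.

(* d/dt phi(t, p) at t = 0, where phi(0, p) = p. *)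
Definition generator (phi : flow) (p : torus) : 'rV[R]_n :=
  derive1 (fun t : R => chart p (phi t p)) 0.

Definition is_multiplier (phi : flow) (f : diffeo) (alpha : R) : Prop :=
  alpha != 0 /\
  forall p, pushforward f (generator phi) p = alpha *: generator phi p.

Definition multiplier_group (phi : flow) : set R :=
  [set alpha | exists f : diffeo, is_multiplier phi f alpha].

Definition Qfree (a : 'rV[R]_n) : Prop :=
  forall c : 'rV[rat]_n, \sum_i ratr (c 0 i) * a 0 i = 0 -> c = 0.

Definition quasiperiodic (phi : flow) : Prop :=
  exists (f : diffeo) (Y : 'rV[R]_n),
    Qfree Y /\ forall p, pushforward f (generator phi) p = Y.

(* A [divringClosed R] on the field R is a subfield of R. *)
Definition Qbasis (F : divringClosed R) (b : 'rV[R]_n) : Prop :=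
  [/\ forall i, b 0 i \in F,
      Qfree b &
      forall x, x \in F ->
        exists c : 'rV[rat]_n, x = \sum_i ratr (c 0 i) * b 0 i].

Definition number_field_of_degree (F : divringClosed R) : Prop :=
  exists b : 'rV[R]_n, Qbasis F b.

Definition F_algebraic (F : divringClosed R) (phi : flow) : Prop :=
  exists a : 'rV[R]_n, (forall p, generator phi p = a) /\
    exists theta : R, theta != 0 /\ Qbasis F (theta *: a).

End Torus.

Section Integers.
Variable R : realType.

Definition ring_of_integers (F : divringClosed R) : set R :=
  [set x | x \in F /\ integralOver (intr : int -> R) x].

Definition unit_group (A : set R) : set R :=
  [set x | A x /\ exists2 y, A y & x * y = 1].

Definition is_mul_subgroup (H G : set R) : Prop :=
  [/\ H `<=` G,
      H 1,
      forall x y, H x -> H y -> H (x * y) &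
      forall x, H x -> H x^-1].

End Integers.

Arguments number_field_of_degree {R} n F.

(* Main.v *)
From HB Require Import structures.
Require Import Defs.
From mathcomp Require Import all_boot all_order all_algebra.
From mathcomp Require Import all_classical all_reals all_analysis.
From mathcomp Require Import ring_quotient lra.

Set Implicit Arguments.
Unset Strict Implicit.
Unset Printing Implicit Defensive.
Import Order.TTheory GRing.Theory Num.Theory.
Import numFieldNormedType.Exports.
Local Open Scope classical_set_scope.
Local Open Scope ring_scope.

(** A generalized symmetry of a constant flow on the torus is, up to a bounded
    error, an integer matrix having the direction of the flow as eigenvector.

    Let [f] be a diffeomorphism of the torus whose tangent map sends the constant
    field [a] to [alpha *: a].  A lift [L] of [f] to the universal cover satisfies
    [L (x + m) = L x + m *m B] for integer vectors [m], where the integer matrix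
    [B] is the action of [f] on the fundamental group; hence [L x - x *m B] is
    periodic, and so bounded.  Along the flow line of [a] the lift has constant
    derivative, so [L (t *: a) = L 0 + t *: (alpha *: a)].  Comparing the two as
    [t] grows gives [a *m B = alpha *: a] ([winding] for one coordinate of [f],
    [smooth_map_eigenvector] for [f]).

    The inverse diffeomorphism gives in the same way an integer matrix [C] with
    [a *m C = alpha^-1 *: a].  Then [B *m C] fixes [a], whose components are
    linearly independent over the rationals, so [B *m C] is the identity.
    Conversely an invertible integer matrix with eigenvector [a] induces a linear
    automorphism of the torus which is a generalized symmetry.  Therefore the
    multiplier group is exactly the set of eigenvalues for [a] of the invertible
    integer matrices ([multiplier_groupP]), and that this set is a group is linear
    algebra.

    Finally such an eigenvalue [alpha] is a root of the characteristic polynomial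
    of an integer matrix, hence an algebraic integer; it is in [F] because, for a
    nonzero component [b] of the basis [theta *: a] of [F], [alpha * b] is an
    integral combination of the basis ([eigenvalue_ring_of_integers]).  As
    [alpha^-1] is also a multiplier, [alpha] is a unit. *)

(** * The circle and its centred representatives *)

Section Circle.
Variable R : realType.
Implicit Types (r s : R) (c d : circle R).

Definition cproj (r : R) : circle R := (\pi_(circle R) r)%qT.

Lemma int_small r : r \is a Num.int -> `|r| < 1 -> r = 0.
Proof.
move=> /intrP[m ->]; rewrite -intr_norm -[1]/(1%:~R) ltr_int => m1.
suff -> : m = 0 by [].
by apply/eqP; rewrite -normr_eq0; case: `|m| m1 (normr_ge0 m) => [[|]|].
Qed.

Lemma cproj_eqP r s : reflect (cproj r = cproj s) (r - s \is a Num.int).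
Proof.
rewrite -[_ \is a Num.int]/(r - s \in Zsubgroup R).
by rewrite Quotient.idealrBE; exact: eqP.
Qed.

Lemma cprojD r s : cproj (r + s) = cproj r + cproj s.
Proof. exact: Quotient.pi_add. Qed.

Lemma cprojB r s : cproj (r - s) = cproj r - cproj s.
Proof. by rewrite cprojD; congr (_ + _); exact: Quotient.pi_opp. Qed.

Lemma cproj0 : cproj 0 = 0.
Proof. by apply: (addrI (cproj 0)); rewrite -cprojD !addr0. Qed.

(** All local computations in the circle are done on real representatives and
    certified by this lemma: two reals at distance less than 1 with the same
    class are equal. *)
Lemma cproj_small_inj r s : cproj r = cproj s -> `|r - s| < 1 -> r = s.
Proof. by move=> /cproj_eqP rs rs1; apply/subr0_eq/int_small. Qed.

Lemma centeredK c : cproj (centered c) = c.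
Proof.
rewrite -[RHS](@reprK _ (circle R)); apply/cproj_eqP.
by rewrite /centered addrAC subrr sub0r rpredN intr_int.
Qed.

Lemma centered_itv c : - 2^-1 <= centered c < 2^-1.
Proof.
rewrite /centered.
have /andP[] := floor_itv (repr c + 2^-1); rewrite intrD => h1 h2.
by apply/andP; split; lra.
Qed.

Lemma centered_cproj r : `|r| < 2^-1 -> centered (cproj r) = r.
Proof.
move=> r2; apply: cproj_small_inj; first exact: centeredK.
have /andP[h3 h4] := centered_itv (cproj r).
move: r2; rewrite !ltr_norml => /andP[h1 h2]; apply/andP; split; lra.
Qed.

Lemma centered0 : centered (0 : circle R) = 0.
Proof. by rewrite -cproj0 centered_cproj // normr0 invr_gt0. Qed.

Lemma centeredD c d : `|centered c| < 4^-1 -> `|centered d| < 4^-1 ->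
  centered (c + d) = centered c + centered d.
Proof.
move=> c4 d4; rewrite -[in LHS](centeredK c) -[in LHS](centeredK d) -cprojD.
rewrite centered_cproj //; have := ler_normD (centered c) (centered d); lra.
Qed.

Lemma centeredN c : `|centered c| < 2^-1 -> centered (- c) = - centered c.
Proof.
move=> c2; rewrite -[in LHS](centeredK c) -sub0r -cproj0 -cprojB sub0r.
by rewrite centered_cproj // normrN.
Qed.

End Circle.

(** * Lifting a uniformly continuous map to the circle *)

Section Lift.
Variables (R : realType) (V : normedModType R).
Implicit Types (x y : V) (delta r : R) (k N : nat).

Lemma exists_subdivision x delta : 0 < delta ->
  exists N, `|x| < N.+1%:R * delta.
Proof.
move=> d0; exists (Num.truncn (`|x| / delta)); rewrite -ltr_pdivrMr //.
exact: truncnS_gt.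
Qed.

Lemma subdivision_norm x r k N : (k <= N.+1)%N -> `|x| < r ->
  `|(k%:R / N.+1%:R) *: x| < r.
Proof.
move=> kN xr; apply: le_lt_trans xr.
rewrite normrZ ger0_norm ?divr_ge0 ?ler0n // ler_piMl //.
by rewrite ler_pdivrMr ?ltr0n // mul1r ler_nat.
Qed.

Lemma subdivision_step x delta k N : `|x| < N.+1%:R * delta ->
  `|(k%:R / N.+1%:R) *: x - (k.+1%:R / N.+1%:R) *: x| < delta.
Proof.
move=> xN; rewrite -scalerBl -mulrBl -natr1 opprD addNKr mulN1r.
rewrite scaleNr normrN normrZ ger0_norm ?invr_ge0 // mulrC.
by rewrite ltr_pdivrMr ?ltr0n // mulrC.
Qed.

(** Uniform local constancy propagates along the segment from [0] to [x], cut
    into steps shorter than [delta].  This replaces every appeal to connectedness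
    and to the uniqueness of lifts. *)
Lemma step_const (T : Type) (u : V -> T) delta r : 0 < delta ->
    (forall x y, `|x| < r -> `|y| < r -> `|x - y| < delta -> u x = u y) ->
  forall x, `|x| < r -> u x = u 0.
Proof.
move=> d0 hu x xr; have [N xN] := exists_subdivision x d0.
have Hk k : (k <= N.+1)%N -> u ((k%:R / N.+1%:R) *: x) = u 0.
  elim: k => [_|k IH kN]; first by rewrite mul0r scale0r.
  rewrite -IH ?(ltnW kN) //; apply/esym/hu; last exact: subdivision_step.
    exact: (subdivision_norm (ltnW kN)).
  exact: subdivision_norm.
by rewrite -(Hk N.+1) // divff ?scale1r // pnatr_eq0.
Qed.

Variables (g : V -> circle R) (delta : R).
Hypothesis delta_gt0 : 0 < delta.
Hypothesis g_delta : forall x y, `|x - y| < delta ->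
  `|centered (g y - g x)| < 8^-1.

Let incr x y := centered (g y - g x).

(* The lift at the k-th of the N.+1 steps from 0 to x, normalised to vanish at 0. *)
Let lift_upto N k x := \sum_(i < k)
  incr ((i%:R / N.+1%:R) *: x) ((i.+1%:R / N.+1%:R) *: x).

Let lift_uptoB N k x y : (k <= N.+1)%N ->
    `|x| < N.+1%:R * delta -> `|y| < N.+1%:R * delta -> `|x - y| < delta ->
  lift_upto N k y - lift_upto N k x =
    incr ((k%:R / N.+1%:R) *: x) ((k%:R / N.+1%:R) *: y).
Proof.
move=> + xN yN xy.
elim: k => [_|k IH kN].
  by rewrite /lift_upto !big_ord0 mul0r !scale0r /incr !subrr centered0.
have step m : (m <= N.+1)%N ->
    `|(m%:R / N.+1%:R) *: x - (m%:R / N.+1%:R) *: y| < delta.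
  by move=> mN; rewrite -scalerBr; exact: subdivision_norm.
have := IH (ltnW kN); rewrite /lift_upto !big_ord_recr /= -/(lift_upto N k x).
rewrite -/(lift_upto N k y); set A := _ *: x; set B := _ *: y.
set A' := (k.+1%:R / _) *: x; set B' := (k.+1%:R / _) *: y => IHk.
(* Going from A to B' through B or through A' gives the same increment: both
   sums are below 1/2, so they are the centred representative of g B' - g A. *)
have E : incr A B + incr B B' = incr A A' + incr A' B'.
  rewrite /incr -!centeredD.
  - by congr centered; rewrite [LHS]addrC [RHS]addrC !addrA !subrK.
  - by have := g_delta (subdivision_step k xN : `|A - A'| < delta); lra.
  - by have := g_delta (step _ kN : `|A' - B'| < delta); lra.
  - by have := g_delta (step _ (ltnW kN) : `|A - B| < delta); lra.
  - by have := g_delta (subdivision_step k yN : `|B - B'| < delta); lra.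
lra.
Qed.

Let lift N x := lift_upto N N.+1 x.

Let liftB N x y :
    `|x| < N.+1%:R * delta -> `|y| < N.+1%:R * delta -> `|x - y| < delta ->
  lift N y - lift N x = incr x y.
Proof.
move=> xN yN xy; rewrite [LHS]lift_uptoB //.
by rewrite divff ?scale1r // pnatr_eq0.
Qed.

Let lift0 N : lift N 0 = 0.
Proof.
rewrite /lift /lift_upto big1 // => i _.
by rewrite !scaler0 /incr subrr centered0.
Qed.

(* Two subdivisions give functions with equal increments that agree at 0. *)
Let lift_indep N M x : `|x| < N.+1%:R * delta -> `|x| < M.+1%:R * delta ->
  lift N x = lift M x.
Proof.
move=> xN xM; apply/subr0_eq.
have -> : 0 = lift N 0 - lift M 0 by rewrite !lift0 subrr.
pose r := Num.min (N.+1%:R * delta) (M.+1%:R * delta).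
apply: (@step_const _ (fun z => lift N z - lift M z) delta r) => //.
  move=> u v; rewrite /r !lt_min => /andP[uN uM] /andP[vN vM] uv.
  have := liftB uN vN uv; have := liftB uM vM uv; lra.
by rewrite /r lt_min xN.
Qed.

(** Sum the small increments of [g] along the segment from [0] to [x].  Moving
    the endpoint changes the sum by the increment at the endpoint, since the
    increments around each thin quadrilateral between the two segments cancel;
    the result depends neither on the number of steps nor on their size. *)
Lemma exists_lift : exists L : V -> R,
  forall x y, `|x - y| < delta -> L y - L x = centered (g y - g x).
Proof.
pose N x := Num.truncn (`|x| / delta).
have HN x M : (N x <= M)%N -> `|x| < M.+1%:R * delta.
  move=> NM; rewrite -ltr_pdivrMr //.
  by apply: (lt_le_trans (truncnS_gt _)); rewrite ler_nat.
exists (fun x => lift (N x) x) => x y xy.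
pose M := maxn (N x) (N y).
have xM : `|x| < M.+1%:R * delta by apply: HN; exact: leq_maxl.
have yM : `|y| < M.+1%:R * delta by apply: HN; exact: leq_maxr.
rewrite (lift_indep (HN x _ (leqnn _)) xM) (lift_indep (HN y _ (leqnn _)) yM).
exact: liftB.
Qed.

End Lift.

(** * Winding numbers of a map from the torus to the circle *)

Section Winding.
Variables (R : realType) (n : nat).
Implicit Types (x : 'rV[R]_n) (m : 'rV[int]_n).

Lemma additive_row (M : zmodType) (f : 'rV[int]_n -> M) :
  {morph f : x y / x + y} ->
  forall m, f m = \sum_i f (delta_mx 0 i) *~ m 0 i.
Proof.
move=> fD m.
have f0 : f 0 = 0 by apply: (addrI (f 0)); rewrite -fD !addr0.
have fN k : f (- k) = - f k by apply/eqP; rewrite -addr_eq0 -fD addNr f0.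
have fB : {morph f : k l / k - l} by move=> k l; rewrite fD fN.
pose F : {additive 'rV[int]_n -> M} :=
  HB.pack f (GRing.isZmodMorphism.Build _ _ f fB).
rewrite -[f]/(F : _ -> _) [in LHS](row_sum_delta m) raddf_sum.
by apply: eq_bigr => i _; rewrite -raddfMz -[in RHS]scaler_int intz.
Qed.

Lemma linear_growth_eq0 (d K : R) : (forall t, `|t * d| <= K) -> d = 0.
Proof.
move=> dK; apply/eqP; apply: contraT => d0.
have := dK ((`|K| + 1) / d).
rewrite divfK // ger0_norm; last by rewrite addr_ge0.
by have := ler_norm K; lra.
Qed.

Lemma norm_rV_le x (r : R) : 0 <= r -> (forall i, `|x 0 i| <= r) -> `|x| <= r.
Proof.
move=> r0 xr; rewrite [leLHS]/Num.norm /= mx_normrE.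
by apply/bigmax_leP; split => // -[i j] _ /=; rewrite ord1.
Qed.

Lemma norm_coord_le x i : `|x 0 i| <= `|x|.
Proof.
rewrite [leRHS]/Num.norm /= mx_normrE.
exact: (le_bigmax _ (fun ij => `|x ij.1 ij.2|) (0, i)).
Qed.

Variables (g : 'rV[R]_n -> circle R) (delta : R).
Hypothesis delta_gt0 : 0 < delta.
Hypothesis g_delta : forall x y, `|x - y| < delta ->
  `|centered (g y - g x)| < 8^-1.
Hypothesis g_periodic : forall x m, g (x + map_mx intr m) = g x.

(** With [L] a lift of [g], [L (x + m) - L x] is independent of [x], so it is an
    integral linear form in [m] with coefficients [b], the winding numbers of [g].
    The difference between [L] and this form is bounded, whereas on the line
    spanned by [a] the lift grows linearly at rate [lambda]. *)
Lemma winding (a : 'rV[R]_n) (lambda : R) :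
  (forall x, is_derive (0 : R) 1
     (fun t => centered (g (x + t *: a) - g x)) lambda) ->
  exists b : 'cV[int]_n, lambda = \sum_i a 0 i * (b i 0)%:~R.
Proof.
move=> g'; have [L HL] := exists_lift delta_gt0 g_delta.
have const T (u : 'rV[R]_n -> T) :
    (forall x y, `|x - y| < delta -> u x = u y) -> forall x, u x = u 0.
  move=> hu x; apply: (@step_const _ _ _ u delta (`|x| + 1)) => //.
    by move=> y z _ _; exact: hu.
  by rewrite ltrDl.
have Lflow t : L (t *: a) - L 0 = t * lambda.
  pose u (s : R) := L (s *: a) - s * lambda.
  have : u t = u 0.
    apply: is_derive_0_is_cst => s.
    (* Near s the function u coincides with v, whose derivative is given by g'. *)
    pose c (h : R) := centered (g (s *: a + h *: a) - g (s *: a)).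
    pose v (r : R) := L (s *: a) + c (r - s) - r * lambda.
    have dv : is_derive s (1 : R) v 0.
      have dc : is_derive s (1 : R) (fun r : R => c (r - s)) lambda.
        rewrite -[lambda]mulr1.
        apply: (@is_derive1_comp _ c (fun r : R => r - s) s lambda 1).
          by rewrite /= subrr; exact: g'.
        by apply: is_derive_eq; rewrite subr0.
      apply: is_derive_eq.
      by rewrite add0r mul1r scaler0 add0r /GRing.scale /= mulr1 subrr.
    apply: near_eq_is_derive dv; near=> r.
    rewrite /u /v /c -HL; last first.
      rewrite opprD addNKr normrN normrZ.
      (* The summand 1 keeps the denominator positive when a = 0. *)
      apply: (@le_lt_trans _ _ (`|r - s| * (`|a| + 1))).
        by rewrite ler_wpM2l // lerDl.
      rewrite -ltr_pdivlMr; last by rewrite ltr_wpDl.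
      rewrite distrC; near: r; apply: cvgr_dist_lt => //.
      by rewrite divr_gt0 // ltr_wpDl.
    by rewrite -scalerDl addrC (addrC s) subrK; lra.
  by rewrite /u scale0r mul0r; lra.
have Lshift m x : L (x + map_mx intr m) - L x = L (map_mx intr m) - L 0.
  rewrite (const _ (fun z => L (z + map_mx intr m) - L z)) ?add0r // => y z yz.
  have yz' : `|y + map_mx intr m - (z + map_mx intr m)| < delta.
    by rewrite opprD addrACA subrr addr0.
  have := HL _ _ yz'; have := HL _ _ yz; rewrite !g_periodic; lra.
pose beta m := L (map_mx intr m) - L 0.
have betaD : {morph beta : k l / k + l}.
  move=> k l; rewrite /beta -(Lshift l (map_mx intr k)) map_mxD; lra.
have beta_int m : beta m \is a Num.int.
  apply/cproj_eqP.
  have H : cproj (L (map_mx intr m)) - g (map_mx intr m) = cproj (L 0) - g 0.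
    apply: (const _ (fun z => cproj (L z) - g z)) => x y xy.
    rewrite -[L y](subrK (L x)) HL // cprojD centeredK.
    by rewrite [RHS]addrAC [g y - g x]addrC addrK addrC.
  have gm : g (map_mx intr m) = g 0 by rewrite -(g_periodic 0 m) add0r.
  by move: H; rewrite gm => /subIr.
(* On the unit ball N.+1 steps of increment less than 1/8 suffice. *)
have [N HN] := exists_subdivision (1 : R) delta_gt0.
pose C := N.+1%:R * 8^-1 : R.
have Lbound x : `|x| <= 1 -> `|L x - L 0| <= C.
  move=> x1; have xN : `|x| < N.+1%:R * delta.
    by apply: le_lt_trans x1 _; move: HN; rewrite normr1.
  have Hk k : (k <= N.+1)%N ->
      `|L ((k%:R / N.+1%:R) *: x) - L 0| <= k%:R * 8^-1.
    elim: k => [|k IH kN]; first by rewrite mul0r scale0r subrr normr0 mul0r.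
    have h1 := IH (ltnW kN); have h2 := g_delta (subdivision_step k xN).
    rewrite -HL in h2; last exact: subdivision_step.
    rewrite -[X in _ <= X * _]natr1.
    apply: le_trans (ler_distD (L ((k%:R / N.+1%:R) *: x)) _ _) _; lra.
  by have := Hk N.+1 (leqnn _); rewrite divff ?scale1r ?pnatr_eq0.
pose b : 'cV[int]_n := \col_i Num.floor (beta (delta_mx 0 i)).
have bE i : beta (delta_mx 0 i) = (b i 0)%:~R.
  by rewrite mxE; apply/esym/eqP; rewrite -intrEfloor.
exists b; apply/subr0_eq.
pose K := \sum_i `|(b i 0)%:~R : R|.
apply: (@linear_growth_eq0 _ (C + K)) => t.
(* Split t *: a into its integral part m and the remainder x in the unit box. *)
pose m : 'rV[int]_n := map_mx Num.floor (t *: a).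
pose x := t *: a - map_mx intr m.
have x1 i : `|x 0 i| <= 1.
  rewrite !mxE; have /andP[] := floor_itv (t * a 0 i); rewrite intrD => h1 h2.
  by rewrite ger0_norm; lra.
have E : t * lambda = beta m + (L x - L 0).
  rewrite -Lflow /beta -(Lshift m x) subrK; lra.
have -> : t * (lambda - \sum_i a 0 i * (b i 0)%:~R) =
    (L x - L 0) - \sum_i x 0 i * (b i 0)%:~R.
  rewrite mulrBr E (additive_row betaD) mulr_sumr addrAC addrC; congr (_ + _).
  rewrite -!sumrB -sumrN; apply: eq_bigr => i _.
  rewrite bE -mulrzl !mxE; lra.
apply: le_trans (ler_normB _ _) _; apply: lerD.
  by apply: Lbound; exact: norm_rV_le.
apply: le_trans (ler_norm_sum _ _ _) _; apply: ler_sum => i _.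
by rewrite normrM ler_piMl.
Unshelve. all: by end_near. Qed.

End Winding.

(** * Smooth maps of the torus that carry one constant field to another *)

Section TorusCharts.
Variables (R : realType) (n : nat).
Implicit Types (p q : torus R n) (x y h : 'rV[R]_n).

Lemma tprojE x i j : tproj x i j = cproj (x i j).
Proof. by rewrite mxE. Qed.

Lemma tprojD x y : tproj (x + y) = tproj x + tproj y.
Proof. by apply/matrixP => i j; rewrite [RHS]mxE !tprojE mxE cprojD. Qed.

Lemma tproj0 : tproj (0 : 'rV[R]_n) = 0.
Proof. by apply/matrixP => i j; rewrite tprojE !mxE cproj0. Qed.

Lemma tproj_int (m : 'rV[int]_n) : tproj (map_mx intr m : 'rV[R]_n) = 0.
Proof.
apply/matrixP => i j; rewrite tprojE !mxE -cproj0.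
by apply/cproj_eqP; rewrite subr0 intr_int.
Qed.

Lemma tproj_surj p : exists x, tproj x = p.
Proof.
exists (\row_i centered (p 0 i)); apply/rowP => i.
by rewrite tprojE mxE centeredK.
Qed.

Lemma chartK p q : p + tproj (chart p q) = q.
Proof. by apply/rowP => i; rewrite !mxE -/(cproj _) centeredK addrC subrK. Qed.

Lemma chart_tproj p h : `|h| < 2^-1 -> chart p (p + tproj h) = h.
Proof.
move=> h2; apply/rowP => i.
rewrite mxE [(p + _) _ _]mxE tprojE addrAC subrr add0r centered_cproj //.
exact: le_lt_trans (norm_coord_le h i) h2.
Qed.

Lemma local_expr0 (f : torus R n -> torus R n) p : local_expr f p 0 = 0.
Proof.
rewrite /local_expr tproj0 addr0; apply/rowP => i.
by rewrite !mxE subrr centered0.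
Qed.

Variable f : torus R n -> torus R n.
Hypothesis f_smooth : smooth_map f.

Lemma smooth_map_differentiable p : differentiable (local_expr f p) 0.
Proof.
have [U [_ U0] fU] := f_smooth p.
by have [/(_ _ U0)] := fU 1%N.
Qed.

(** Continuity in the charts is pointwise; on the closed unit ball it is uniform
    by compactness, and integral translations bring every point into that ball. *)
Lemma smooth_map_uniform i : exists2 delta : R, 0 < delta &
  forall x y, `|x - y| < delta ->
    `|centered (f (tproj y) 0 i - f (tproj x) 0 i)| < 8^-1.
Proof.
pose g x := f (tproj x) 0 i.
have near_g x : \forall y \near x, `|centered (g y - g x)| < 16^-1.
  have : {for 0, continuous (fun h => local_expr f (tproj x) h 0 i)}.
    apply: (@continuous_comp _ _ _ (local_expr f (tproj x)) (fun M => M 0 i)).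
      exact/differentiable_continuous/smooth_map_differentiable.
    exact: coord_continuous.
  move=> /cvgr_dist_lt /(_ 16^-1) H.
  rewrite (near_shift 0); near=> y.
  have : `|local_expr f (tproj x) 0 0 i - local_expr f (tproj x) y 0 i| < 16^-1.
    by near: y; apply: H; rewrite invr_gt0.
  rewrite local_expr0 mxE sub0r normrN /local_expr mxE /=.
  by rewrite subr0 [y + x]addrC /g tprojD.
have cK : compact [set x : 'rV[R]_n | `|x| <= 1].
  apply: bounded_closed_compact.
    exists 1; split => // M M1 x /= x1; apply: le_trans x1 _; exact: ltW.
  apply: (@closed_comp _ _ (fun x : 'rV[R]_n => `|x|)
    [set r : R | r <= 1]); last exact: closed_le.
  by move=> x _; exact: norm_continuous.
pose P (delta : R) x := forall y, `|x - y| < delta ->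
  `|centered (g y - g x)| < 8^-1.
have : \forall delta \near 0^'+, forall x, `|x| <= 1 -> P delta x.
  apply: ((compact_near_coveringP _).1 cK R) => z _.
  have [e /= e0 ze] := (nbhs_ballP _ _).1 (near_g z).
  near=> x delta => y xy.
  have xz : `|z - x| < e / 2.
    near: x; apply: cvgr_dist_lt => //; exact: divr_gt0.
  have de : delta < e / 2.
    near: delta; apply: nbhs_right_lt; exact: divr_gt0.
  have gx : `|centered (g x - g z)| < 16^-1.
    apply: ze; rewrite -ball_normE /=; lra.
  have gy : `|centered (g y - g z)| < 16^-1.
    apply: ze; rewrite -ball_normE /=.
    apply: le_lt_trans (ler_distD x _ _) _.
    by rewrite [e]splitr ltrD // (lt_trans xy).
  have -> : g y - g x = (g y - g z) + - (g x - g z).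
    by rewrite opprB addrA subrK.
  have gxN : centered (- (g x - g z)) = - centered (g x - g z).
    by rewrite centeredN; lra.
  rewrite centeredD ?gxN ?normrN; [|lra|lra].
  by apply: le_lt_trans (ler_normB _ _) _; lra.
move=> P0.
have : \forall delta \near 0^'+,
    0 < delta /\ forall x, `|x| <= 1 -> P delta x.
  by near=> delta; split; [near: delta; exact: nbhs_right_gt|near: delta].
move=> /filter_ex [delta [d0 Pd]]; exists delta => // x y xy.
pose m : 'rV[R]_n := map_mx intr (map_mx Num.floor x).
have gE z : f (tproj (z - m)) 0 i = f (tproj z) 0 i.
  by rewrite -[in RHS](subrK m z) [in RHS]tprojD tproj_int addr0.
rewrite -gE -(gE x); apply: Pd; last by rewrite opprB addrA subrK.
apply: norm_rV_le => // j; rewrite !mxE.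
have /andP[] := floor_itv (x 0 j); rewrite intrD => h1 h2.
by rewrite ger0_norm; lra.
Unshelve. all: by end_near. Qed.

(** The columns of [B] are the winding numbers of the coordinates of [f]; [B] is
    the map induced by [f] on the fundamental group. *)
Lemma smooth_map_eigenvector (a v : 'rV[R]_n) :
  (forall p, tangent_map f p a = v) ->
  exists B : 'M[int]_n, v = a *m map_mx intr B.
Proof.
move=> fav.
have /choice[b bE] : forall j, exists b : 'cV[int]_n,
    v 0 j = \sum_i a 0 i * (b i 0)%:~R.
  move=> j; have [delta d0 fd] := smooth_map_uniform j.
  apply: (winding d0 fd) => [x m|x]; first by rewrite tprojD tproj_int addr0.
  pose F := local_expr f (tproj x).
  have dF : derivable F 0 a by exact/diff_derivable/smooth_map_differentiable.
  have FE : (fun t => F (t *: a + 0) 0 j) = (fun t : R =>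
      centered (f (tproj (x + t *: a)) 0 j - f (tproj x) 0 j)).
    by apply/funext => t; rewrite /F /local_expr mxE addr0 tprojD.
  have dFj : derivable (fun h => F h 0 j) 0 a by exact: (derivable_mxP _ _ _).1.
  rewrite -FE; split; first exact: ((derivable1P _ _ _).1 dFj).
  rewrite -(fav (tproj x)) /tangent_map -deriveE; last first.
    exact: smooth_map_differentiable.
  rewrite -/F derive_mx // mxE /derive.
  set g1 := fun h : R => h^-1 *: _; set g2 := fun h : R => h^-1 *: _.
  suff -> : g1 = g2 by [].
  apply/funext => t; rewrite /g1 /g2 /=.
  by rewrite scale0r !addr0 [t *: 1]mulr1.
exists (\matrix_(i, j) b j i 0); apply/rowP => j; rewrite bE mxE.
by apply: eq_bigr => i _; rewrite !mxE.
Qed.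

End TorusCharts.

(** * Differentials of local inverses and of locally affine maps *)

Section SmoothLinear.
Variables (R : realType) (V W : normedModType R).

Lemma diff_local_inverse (F : V -> W) (G : W -> V) x y v : F x = y ->
    differentiable F x -> differentiable G y ->
    (\forall z \near x, G (F z) = z) ->
  'd G y ('d F x v) = v.
Proof.
move=> <- dF dG GF.
have -> : 'd G (F x) ('d F x v) = 'd (G \o F) x v
  by rewrite (diff_comp dF dG).
rewrite -deriveE; last exact: differentiable_comp.
by rewrite (@near_eq_derive _ _ _ _ id _ _ GF) derive_id.
Qed.

Lemma near_eq_differentiable (f : V -> W) (l : {linear V -> W}) (c : W) x :
  continuous l -> (\forall y \near x, f y = l y + c) ->
  differentiable f x /\ 'd f x = l :> (V -> W).
Proof.
move=> lc fl.
have fx : f \o shift x = cst (f x) + l +o_ 0 id.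
  apply/eqaddoP => e e0; near=> h.
  have -> : (f \o shift x - (cst (f x) + l)) h = 0.
    rewrite /= !fctE /= (nbhs_singleton fl).
    have -> : f (h + x) = l (h + x) + c.
      near: h; move: fl; rewrite (near_shift 0) /= => fl.
      by apply: filterS fl => h; rewrite /shift /= subr0.
    by rewrite linearD [l x + c + l h]addrC addrA subrr.
  by rewrite normr0 mulr_ge0 // ltW.
have dfx : 'd f x = l :> (V -> W) by exact: diff_unique.
split => //; apply/diff_locallyP; rewrite dfx; split=> //.
Unshelve. all: by end_near. Qed.

(** Affine maps rather than linear ones make the induction go through: the map
    [x |-> 'd f x v] is then the constant [l v], which is again affine. *)
Lemma Ck_affine k (U : set V) (f : V -> W) (l : {linear V -> W}) (c : W) :
  open U -> continuous l -> (forall x, U x -> f x = l x + c) -> Ck k U f.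
Proof.
move=> oU; elim: k f l c => [|k IH] f l c lc fl; have nfl x : U x ->
    \forall y \near x, f y = l y + c.
- by move=> Ux; apply: filterS (open_nbhs_nbhs (conj oU Ux)).
- move=> x Ux; apply: differentiable_continuous.
  by have [] := near_eq_differentiable lc (nfl x Ux).
- by move=> Ux; apply: filterS (open_nbhs_nbhs (conj oU Ux)).
- split=> [x Ux|v]; first by have [] := near_eq_differentiable lc (nfl x Ux).
  apply: (IH _ \0 (l v)) => [|x Ux]; first exact: cst_continuous.
  by rewrite add0r; have [_ ->] := near_eq_differentiable lc (nfl x Ux).
Qed.

End SmoothLinear.

Lemma mulmxr_continuous (R : realType) m n (M : 'M[R]_(m, n)) :
  continuous (mulmxr M : 'rV[R]_m -> 'rV[R]_n).
Proof.
apply: bounded_linear_continuous; apply/linear_boundedP.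
pose K := \sum_j \sum_i `|M i j|.
near=> r => x; apply: norm_rV_le => [|j]; first by rewrite mulr_ge0.
rewrite /= mxE; apply: le_trans (ler_norm_sum _ _ _) _.
apply: (@le_trans _ _ (K * `|x|)); last by rewrite ler_wpM2r.
rewrite /K mulr_suml (bigD1 j) //= mulr_suml -[leLHS]addr0; apply: lerD.
  apply: ler_sum => i _; rewrite normrM mulrC ler_wpM2l //.
  exact: norm_coord_le.
by apply: sumr_ge0 => k _; rewrite mulr_ge0 // sumr_ge0.
Unshelve. all: by end_near. Qed.

(** * Linear automorphisms of the torus *)

Section Automorphisms.
Variables (R : realType) (n : nat).
Implicit Types (p q : torus R n) (x h : 'rV[R]_n) (B C : 'M[int]_n).

Lemma tproj_eq x y : tproj x = tproj y ->
  exists m : 'rV[int]_n, x = y + map_mx intr m.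
Proof.
move=> xy; exists (map_mx Num.floor (x - y)); apply/rowP => i; rewrite !mxE.
have : x 0 i - y 0 i \is a Num.int.
  by apply/cproj_eqP; rewrite -!tprojE xy.
by move=> /floorK ->; rewrite addrC subrK.
Qed.

(** Representatives of the coordinates are needed to apply the matrix; the choice
    of the centred ones is immaterial by [torus_linear_tproj]. *)
Definition torus_linear B p : torus R n :=
  tproj ((\row_i centered (p 0 i)) *m map_mx intr B).

Lemma torus_linear_tproj B x :
  torus_linear B (tproj x) = tproj (x *m map_mx intr B).
Proof.
rewrite /torus_linear.
have : tproj (\row_i centered (tproj x 0 i)) = tproj x.
  by apply/rowP => i; rewrite [LHS]tprojE mxE centeredK.
move=> /tproj_eq[m ->].
by rewrite mulmxDl -map_mxM tprojD tproj_int addr0.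
Qed.

Lemma torus_linear1 p : torus_linear 1%:M p = p.
Proof.
by have [x <-] := tproj_surj p; rewrite torus_linear_tproj map_mx1 mulmx1.
Qed.

Lemma torus_linearM B C p :
  torus_linear (B *m C) p = torus_linear C (torus_linear B p).
Proof.
have [x <-] := tproj_surj p.
by rewrite !torus_linear_tproj map_mxM mulmxA.
Qed.

Lemma torus_linear_local_expr B p h : `|h *m map_mx intr B| < 2^-1 ->
  local_expr (torus_linear B) p h = h *m map_mx intr B.
Proof.
have [x <-] := tproj_surj p; rewrite /local_expr -tprojD !torus_linear_tproj.
by rewrite mulmxDl tprojD => /chart_tproj ->.
Qed.

Let torus_linear_dom B : set 'rV[R]_n :=
  [set h | `|h *m map_mx intr B| < 2^-1].

Let torus_linear_dom_open B :
  open_nbhs (0 : 'rV[R]_n) (torus_linear_dom B).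
Proof.
split; last by rewrite /torus_linear_dom /= mul0mx normr0 invr_gt0.
apply: (@open_comp _ _ (fun h : 'rV[R]_n => `|h *m map_mx intr B|)
  [set r : R | r < 2^-1]); last exact: open_lt.
move=> h _.
have hB : {for h, continuous (mulmxr (map_mx intr B) : 'rV[R]_n -> 'rV[R]_n)}.
  exact: mulmxr_continuous.
exact: (continuous_comp hB (@norm_continuous _ _ _)).
Qed.

Lemma torus_linear_smooth B : smooth_map (torus_linear B).
Proof.
move=> p; exists (torus_linear_dom B); first exact: torus_linear_dom_open.
move=> k; apply: (@Ck_affine _ _ _ _ _ _ (mulmxr (map_mx intr B)) 0).
- exact: (torus_linear_dom_open B).1.
- exact: mulmxr_continuous.
- by move=> h hB; rewrite addr0 torus_linear_local_expr.
Qed.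

Lemma tangent_map_torus_linear B p v :
  tangent_map (torus_linear B) p v = v *m map_mx intr B.
Proof.
rewrite /tangent_map.
have [|_ ->//] := @near_eq_differentiable _ _ _ (local_expr (torus_linear B) p)
  (mulmxr (map_mx intr B)) 0 0 (@mulmxr_continuous _ _ _ _).
apply: filterS (open_nbhs_nbhs (torus_linear_dom_open B)) => h hB.
by rewrite addr0 torus_linear_local_expr.
Qed.

Definition torus_automorphism B C (BC : B *m C = 1%:M) (CB : C *m B = 1%:M) :
  diffeo R n.
Proof.
apply: (@Diffeo _ _ (torus_linear B) (torus_linear C)).
- by move=> p; rewrite -torus_linearM BC torus_linear1.
- by move=> p; rewrite -torus_linearM CB torus_linear1.
- exact: torus_linear_smooth.
- exact: torus_linear_smooth.
Defined.

(** The expressions of [f] and of its inverse in the charts centred at [p] and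
    [f p] compose to the identity near [0]. *)
Lemma tangent_map_inv (f : diffeo R n) p v :
  tangent_map (diffeo_inv f) (f p) (tangent_map f p v) = v.
Proof.
have near_small : \forall h \near (0 : 'rV[R]_n), `|h| < 2^-1.
  near=> h; rewrite -[h]opprK normrN -sub0r; near: h.
  by apply: cvgr_dist_lt => //; rewrite invr_gt0.
apply: (@diff_local_inverse _ _ _ (local_expr f p)
  (local_expr (diffeo_inv f) (f p)) 0 0 v (local_expr0 f p)).
- exact: (smooth_map_differentiable (diffeo_smooth f)).
- exact: (smooth_map_differentiable (diffeo_inv_smooth f)).
- apply: filterS near_small => h h2.
  by rewrite /local_expr chartK !diffeoK chart_tproj.
Unshelve. all: by end_near. Qed.

End Automorphisms.

(** * The multiplier group as a set of eigenvalues *)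

Section Multipliers.
Variables (R : realType) (n : nat).
Implicit Types (a : 'rV[R]_n) (B C : 'M[int]_n).

Lemma Qfree_scale (theta : R) a : theta != 0 -> Qfree (theta *: a) -> Qfree a.
Proof.
move=> theta0 free c c0; apply: free.
under eq_bigr do rewrite mxE mulrCA.
by rewrite -mulr_sumr c0 mulr0.
Qed.

Lemma Qfree_neq0 a : (0 < n)%N -> Qfree a -> a != 0.
Proof.
case: n a => // k a _ free; apply/eqP => a0.
have /rowP/(_ 0) : (const_mx 1 : 'rV[rat]_k.+1) = 0.
  by apply: free; rewrite big1 // => i _; rewrite a0 [X in _ * X]mxE mulr0.
by rewrite !mxE => /eqP; rewrite oner_eq0.
Qed.

Lemma Qfree_mulmx_inj a B C : Qfree a ->
  a *m map_mx intr B = a *m map_mx intr C -> B = C.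
Proof.
move=> free BC; apply/matrixP => i j.
have /rowP/(_ i) : (\row_i (B i j - C i j)%:~R : 'rV[rat]_n) = 0.
  apply: free.
  have /rowP/(_ j) : a *m map_mx intr B - a *m map_mx intr C = 0.
    by rewrite BC subrr.
  rewrite !mxE -sumrB => {2}<-; apply: eq_bigr => k _.
  by rewrite !mxE ratr_int -mulrBr -intrB mulrC.
by rewrite !mxE => /eqP; rewrite intr_eq0 subr_eq0 => /eqP.
Qed.

Lemma multiplier_constantE (phi : flow R n) a (f : diffeo R n) (alpha : R) :
    (forall p, generator phi p = a) ->
  is_multiplier phi f alpha <->
  alpha != 0 /\ forall p, tangent_map f p a = alpha *: a.
Proof.
move=> phia; split=> -[alpha0 fa]; split=> // p.
  by have := fa (f p); rewrite /Defs.pushforward !phia diffeoK.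
by rewrite /Defs.pushforward !phia.
Qed.

(** From left to right, the matrices given by a symmetry and by its inverse are
    inverse to each other because their product fixes the rationally independent
    vector [a]; from right to left, [B] itself acts on the torus. *)
Lemma multiplier_groupP (phi : flow R n) a (alpha : R) :
    (forall p, generator phi p = a) -> Qfree a ->
  multiplier_group phi alpha <->
  alpha != 0 /\ exists B C, B *m C = 1%:M /\ a *m map_mx intr B = alpha *: a.
Proof.
move=> phia free; split=> [[f] /(multiplier_constantE _ _ phia)|].
  move=> [alpha0 fa]; split => //.
  have [B BE] := smooth_map_eigenvector (diffeo_smooth f) fa.
  have fa' p : tangent_map (diffeo_inv f) p a = alpha^-1 *: a.
    rewrite -[p](diffeo_invK f) -[in LHS](scale1r a) -(mulVf alpha0) -scalerA.
    rewrite /tangent_map linearZ -/(tangent_map _ _ _).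
    by rewrite -(fa (diffeo_inv f p)) tangent_map_inv.
  have [C CE] := smooth_map_eigenvector (diffeo_inv_smooth f) fa'.
  exists B, C; split; last exact/esym.
  apply: (Qfree_mulmx_inj free).
  rewrite map_mxM mulmxA -BE -scalemxAl -CE scalerA mulfV //.
  by rewrite map_mx1 mulmx1 scale1r.
move=> [alpha0 [B [C [BC Ba]]]].
exists (torus_automorphism R BC (mulmx1C BC)).
apply/(multiplier_constantE _ _ phia); split=> // p.
by rewrite -Ba; exact: tangent_map_torus_linear.
Qed.

(** [alpha] is a root of the characteristic polynomial of [B], and lies in [F] as
    the quotient of the [i]-th components of [theta *: a *m B] and [theta *: a],
    for an [i] at which the latter does not vanish. *)
Lemma eigenvalue_ring_of_integers (F : divringClosed R) (theta : R) a B
    (alpha : R) :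
    a != 0 -> theta != 0 -> Qbasis F (theta *: a) ->
    a *m map_mx intr B = alpha *: a ->
  ring_of_integers F alpha.
Proof.
move=> a0 theta0 [aF _ _] Ba; split.
  have [i ai] : exists i, (theta *: a) 0 i != 0.
    by apply/rV0Pn; rewrite scaler_eq0 negb_or theta0.
  have E : alpha * (theta *: a) 0 i = \sum_j (theta *: a) 0 j * (B j i)%:~R.
    have /rowP/(_ i) : (theta *: a) *m map_mx intr B = alpha *: (theta *: a).
      by rewrite -scalemxAl Ba !scalerA mulrC.
    by rewrite !mxE => <-; apply: eq_bigr => j _; rewrite !mxE.
  rewrite -[alpha](mulfK ai) E rpred_div ?aF // rpred_sum // => j _.
  by rewrite rpredM ?aF ?rpred_int.
exists (char_poly B); first exact: char_poly_monic.
rewrite map_char_poly -eigenvalue_root_char.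
by apply/eigenvalueP; exists a.
Qed.

End Multipliers.

Theorem theorem3p4 (R : realType) (n : nat) (F : divringClosed R)
    (phi : flow R n) (a : 'rV[R]_n) :
  (2 <= n)%N ->
  number_field_of_degree n F ->
  quasiperiodic phi ->
  (forall p : torus R n, generator phi p = a) ->
  F_algebraic F phi ->
  is_mul_subgroup (multiplier_group phi) (unit_group (ring_of_integers F)).
Proof.
move=> n2 _ _ phia [a' [phia' [theta [theta0 aF]]]].
have {a' phia'} aF : Qbasis F (theta *: a) by rewrite -(phia 0) phia'.
have free : Qfree a by case: aF => _ + _; exact: Qfree_scale.
have a0 : a != 0 by apply: Qfree_neq0 free; exact: ltnW.
have invP alpha : multiplier_group phi alpha -> multiplier_group phi alpha^-1.
  move=> /(multiplier_groupP _ phia free)[alpha0 [B [C [BC Ba]]]].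
  apply/(multiplier_groupP _ phia free); split; first by rewrite invr_eq0.
  exists C, B; split; first exact: mulmx1C.
  have {1}-> : a = alpha^-1 *: (a *m map_mx intr B).
    by rewrite Ba scalerA mulVf // scale1r.
  by rewrite -scalemxAl -mulmxA -map_mxM BC map_mx1 mulmx1.
have intP alpha : multiplier_group phi alpha -> ring_of_integers F alpha.
  move=> /(multiplier_groupP _ phia free)[_ [B [_ [_ Ba]]]].
  exact: eigenvalue_ring_of_integers a0 theta0 aF Ba.
split=> [alpha Ha||alpha beta|].
- split; first exact: intP.
  exists alpha^-1; first exact/intP/invP.
  by move: Ha => /(multiplier_groupP _ phia free)[alpha0 _]; rewrite mulfV.
- apply/(multiplier_groupP _ phia free); split; first exact: oner_neq0.
  by exists 1%:M, 1%:M; rewrite map_mx1 !mulmx1 scale1r.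
- move=> /(multiplier_groupP _ phia free)[alpha0 [B [B' [BB' Ba]]]].
  move=> /(multiplier_groupP _ phia free)[beta0 [C [C' [CC' Ca]]]].
  apply/(multiplier_groupP _ phia free); split; first by rewrite mulf_neq0.
  exists (B *m C), (C' *m B'); split.
    by rewrite mulmxA -(mulmxA B) CC' mulmx1.
  by rewrite map_mxM mulmxA Ba -scalemxAl Ca scalerA.
- exact: invP.
Qed.
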